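(* Let $N\ge2$, $m\ge3$ be integers and $0<K<N$. Then $\mathrm{PW}_{2K}(\mathcal{B}_N\square\,\mathcal{C}_m)$ is the orthogonal direct sum of the spaces (i) $\mathrm{PW}_{2K-4}(\mathcal{B}_N)\otimes\ell^2(\mathcal{C}_m)$, (ii) $\Lambda_{2K-2}(\mathcal{B}_N)\otimes\mathrm{PW}_2(\mathcal{C}_m)$, and (iii) $\Lambda_{2K}(\mathcal{B}_N)\otimes\Lambda_0(\mathcal{C}_m)$. Moreover: 1. The space (i) has dimension $m\sum_{\kappa=0}^{K-2}\binom{N}{\kappa}$. An orthonormal basis of it consists of the vectors $(u,\ell)\mapsto\delta_0(\ell-j)\psi_{\kappa,\nu}(u)$, $j\in\mathbb{Z}_m$, $0\le\kappa\le K-2$, $1\le\nu\le\binom{N}{\kappa}$. For every $f$ in this space, with $\Psi_{\kappa,\nu}(u,\ell)=\delta_0(\ell)\psi_{\kappa,\nu}(u)$, $\|Qf\|^2=\sum_{\kappa=0}^{K-2}\sum_{\nu=1}^{\binom{N}{\kappa}}|\langle Qf,\Psi_{\kappa,\nu}\rangle|^2.$ 2. Suppose $m=4m'+1$ with $m'$ a positive integer. The space (ii) has dimension $\lfloor(m+1)/2\rfloor\binom{N}{K-1}$, and a basis of it consists of the vectors $(u,\ell)\mapsto\bar{D}_{m'}(\ell-2j)\psi_{K-1,\nu}(u)$, $j=0,\dots,(m-1)/2$, $\nu=1,\dots,\binom{N}{K-1}$. For every $f$ in this space, with $\Psi_{K-1,\nu}(u,\ell)=\bar{D}_{m'}(\ell)\psi_{K-1,\nu}(u)$,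 $\left(\tfrac12+\tfrac{1}{2m}\right)\|Qf\|^2=\sum_{\nu=1}^{\binom{N}{K-1}}|\langle Qf,\Psi_{K-1,\nu}\rangle|^2.$ 3. The space (iii) has dimension $\binom{N}{K}$, and an orthonormal basis of it consists of $\Psi_{K,\nu}(u,\ell)=\frac{1}{\sqrt m}\psi_{K,\nu}(u)$, $\nu=1,\dots,\binom{N}{K}$. For every $f$ in this space, $\tfrac1m\|Qf\|^2=\sum_{\nu=1}^{\binom{N}{K}}|\langle Qf,\Psi_{K,\nu}\rangle|^2.$
   Context: For a finite simple undirected graph $\mathcal{G}$, $L(\mathcal{G})$ is the unnormalized Laplacian $(Lf)(v)=\sum_{w\sim v}[f(v)-f(w)]$, $\Lambda_\lambda(\mathcal{G})$ is the $\lambda$-eigenspace of $L(\mathcal{G})$ (the zero space if $\lambda$ is not an eigenvalue), and $\mathrm{PW}_\lambda(\mathcal{G})$ is the span of the eigenvectors of $L(\mathcal{G})$ with eigenvalue at most $\lambda$ (the zero space if $\lambda<0$). The cycle $\mathcal{C}_m$ has vertex set $\mathbb{Z}_m$ with $\ell\sim\ell\pm1$; its eigenvectors are $\ell\mapsto e^{2\pi ik\ell/m}$ with eigenvalues $4\sin^2(\pi k/m)$. The Boolean cube $\mathcal{B}_N$ has vertex set $\mathbb{Z}_2^N$ with $v\sim w$ iff $v-w=e_i$ for a standard basis vector $e_i$; its eigenvalues are $2\kappa$ with multiplicity $\binom{N}{\kappa}$, $\kappa=0,\dots,N$. For each $\kappa$, $\{\psi_{\kappa,\nu}\}_{\nu=1}^{\binom{N}{\kappa}}$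 is an orthonormal basis of $\Lambda_{2\kappa}(\mathcal{B}_N)$. The Cartesian product $\mathcal{B}_N\square\,\mathcal{C}_m$ has vertex set $\mathbb{Z}_2^N\times\mathbb{Z}_m$ with $(u_1,\ell_1)\sim(u_2,\ell_2)$ iff ($u_1\sim u_2$ and $\ell_1=\ell_2$) or ($u_1=u_2$ and $\ell_1\sim\ell_2$). For $g$ on $\mathcal{B}_N$ and $h$ on $\mathcal{C}_m$, $(g\otimes h)(u,\ell)=g(u)h(\ell)$, and $V\otimes W$ is the span of such products. $Q$ is the operator $(Qf)(u,\ell)=f(u,\ell)$ if $\ell=0$ and $0$ otherwise. $\delta_0(\ell)=1$ if $\ell=0$ and $0$ otherwise. For $n\ge0$, $D_n(\ell)=\sum_{k=-n}^n e^{2\pi ik\ell/m}$ and $\bar{D}_n=D_n/\sqrt{m(2n+1)}$ (unit norm in $\ell^2(\mathcal{C}_m)$). Inner products and norms are the standard ones on $\ell^2$ of the vertex set. *)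

(* Defs.v *)
From mathcomp Require Import all_boot all_algebra.
From mathcomp Require Import reals trigo.
From mathcomp.real_closed Require Export complex.
Set Implicit Arguments.
Unset Strict Implicit.
Unset Printing Implicit Defensive.
Import GRing.Theory Num.Theory.
Local Open Scope ring_scope.
Local Open Scope complex_scope.

Definition fn (R : realType) (T : finType) := {ffun T -> R[i]}.

Definition subsp (R : realType) (T : finType) := fn R T -> Prop.

Definition dotp (R : realType) (T : finType) (f g : fn R T) : R[i] :=
  \sum_x f x * (g x)^*.
Definition normsq (R : realType) (T : finType) (f : fn R T) : R[i] :=
  \sum_x `|f x| ^+ 2.

Definition lap (R : realType) (T : finType) (adj : rel T) (f : fn R T) : fn R T :=
  [ffun v => \sum_(w | adj v w) (f v - f w)].

(* Lambda_lam(G): the lam-eigenspace (zero space when lam is not an eigenvalue). *)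
Definition eigsp (R : realType) (T : finType) (adj : rel T) (lam : R) : subsp R T :=
  fun f => lap adj f = lam%:C *: f.

(* An eigenvector with eigenvalue mu (mu real: the Laplacian is symmetric). *)
Definition eigvec_le (R : realType) (T : finType) (adj : rel T) (lam : R) (v : fn R T) :=
  v != 0 /\ exists mu : R, mu <= lam /\ lap adj v = mu%:C *: v.

Definition PW (R : realType) (T : finType) (adj : rel T) (lam : R) : subsp R T :=
  fun f => exists (n : nat) (c : 'I_n -> R[i]) (v : 'I_n -> fn R T),
    (forall i, eigvec_le adj lam (v i)) /\ f = \sum_i c i *: v i.

Definition fullsp (R : realType) (T : finType) : subsp R T := fun _ => True.

Definition is_basis (R : realType) (T : finType) (I : finType)
    (P : subsp R T) (b : I -> fn R T) :=
  (forall i, P (b i)) /\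
  (forall c : I -> R[i], \sum_i c i *: b i = 0 -> forall i, c i = 0) /\
  (forall f, P f -> exists c : I -> R[i], f = \sum_i c i *: b i).

Definition onb (R : realType) (T : finType) (I : finType)
    (P : subsp R T) (b : I -> fn R T) :=
  is_basis P b /\ forall i j, dotp (b i) (b j) = (i == j)%:R.

Definition has_dim (R : realType) (T : finType) (P : subsp R T) (d : nat) :=
  exists b : 'I_d -> fn R T, is_basis P b.

Definition odsum3 (R : realType) (T : finType) (P A B C : subsp R T) :=
  (forall f, P f <-> exists a b c, [/\ A a, B b, C c & f = a + b + c]) /\
  (forall a b, A a -> B b -> dotp a b = 0) /\
  (forall a c, A a -> C c -> dotp a c = 0) /\
  (forall b c, B b -> C c -> dotp b c = 0).

Definition tens (R : realType) (T1 T2 : finType) (g : fn R T1) (h : fn R T2)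
  : fn R (T1 * T2)%type := [ffun p => g p.1 * h p.2].

Definition tens_sp (R : realType) (T1 T2 : finType) (V : subsp R T1) (W : subsp R T2)
  : subsp R (T1 * T2)%type :=
  fun f => exists (n : nat) (g : 'I_n -> fn R T1) (h : 'I_n -> fn R T2),
    (forall i, V (g i) /\ W (h i)) /\ f = \sum_i tens (g i) (h i).

Definition cube_adj (N : nat) : rel 'rV['Z_2]_N :=
  fun v w => [exists i : 'I_N, v - w == delta_mx 0 i].

Definition cycle_adj (m : nat) : rel 'Z_m :=
  fun l1 l2 => (l2 == l1 + 1) || (l2 == l1 - 1).

Definition box_adj (T1 T2 : finType) (a1 : rel T1) (a2 : rel T2) : rel (T1 * T2)%type :=
  fun p q => (a1 p.1 q.1 && (p.2 == q.2)) || ((p.1 == q.1) && a2 p.2 q.2).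

Definition Qop (R : realType) (N m : nat) (f : fn R ('rV['Z_2]_N * 'Z_m)%type)
  : fn R ('rV['Z_2]_N * 'Z_m)%type :=
  [ffun p => if p.2 == 0 then f p else 0].

Definition delta0 (R : realType) (m : nat) (l : 'Z_m) : R[i] :=
  if l == 0 then 1 else 0.

Definition expi (R : realType) (theta : R) : R[i] := cos theta +i* sin theta.

(* D_n(l) = sum_{k=-n}^{n} e^{2 pi i k l / m}, l in Z_m represented by 0 <= l < m *)
Definition Dir (R : realType) (m n : nat) (l : 'Z_m) : R[i] :=
  \sum_(j < n.*2.+1)
     expi (2 * pi * ((j%:R - n%:R) * (val l)%:R) / m%:R : R).

Definition Dbar (R : realType) (m n : nat) (l : 'Z_m) : R[i] :=
  @Dir R m n l / (Num.sqrt ((m * n.*2.+1)%:R : R))%:C.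

Arguments Dir {R} m n l.
Arguments Dbar {R} m n l.
Arguments delta0 {R} m l.
Arguments Qop {R} N m f.
Arguments fullsp {R T}.
Arguments cube_adj : clear implicits.
Arguments cycle_adj : clear implicits.

(* Main.v *)
Require Import Defs.
From mathcomp Require Import all_boot all_algebra.
From mathcomp Require Import reals trigo.
From mathcomp.real_closed Require Import complex.
From mathcomp Require Import all_order ring lra zify boolp.
Import Order.TTheory GRing.Theory Num.Theory.
Local Open Scope complex_scope.
Local Open Scope ring_scope.

Set Implicit Arguments.
Unset Strict Implicit.
Unset Printing Implicit Defensive.

(* Once a graph has an orthonormal basis of Laplacian eigenvectors, every
   eigenspace and every Paley-Wiener space is the coordinate subspace of the basis
   vectors with the right eigenvalues, and tensoring two such bases diagonalises
   the Laplacian of the Cartesian product with eigenvalues added.  On the cube the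
   vectors psi_{kappa,nu} form such a basis by counting, as the binomial
   coefficients sum to 2^N; on the cycle the characters do, with eigenvalues
   4 sin^2(pi k / m) in [0, 4].  So 2 kappa + mu <= 2 K holds iff kappa <= K - 2,
   or kappa = K - 1 and mu <= 2, or kappa = K and mu = 0.
   For f = sum_nu psi_nu (x) h_nu, only the values h_nu(0) enter Qf, so each norm
   identity is Parseval's identity for the slice f(., 0) multiplied by |w(0)|^2,
   where w is the cycle factor of Psi.  When m = 4 m' + 1, the translates of the
   Dirichlet kernel are obtained from the 2 m' + 1 low-frequency characters by a
   Vandermonde matrix, whose nodes are distinct because m is odd. *)

(** * Orthonormal bases in the space of functions on a finite set *)

Section LinearAlgebra.
Variables (R : realType) (T : finType).
Implicit Types (f g : fn R T) (P : subsp R T).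

Lemma fn_sumE (I : Type) (r : seq I) (Q : pred I) (c : I -> R[i])
  (b : I -> fn R T) x :
  (\sum_(i <- r | Q i) c i *: b i) x = \sum_(i <- r | Q i) c i * b i x.
Proof. by rewrite sum_ffunE; apply: eq_bigr => i _; rewrite !ffunE. Qed.

Lemma dotp_suml (I : Type) (r : seq I) (Q : pred I) (c : I -> R[i])
  (b : I -> fn R T) g :
  dotp (\sum_(i <- r | Q i) c i *: b i) g = \sum_(i <- r | Q i) c i * dotp (b i) g.
Proof.
rewrite /dotp; under eq_bigr do rewrite fn_sumE mulr_suml.
rewrite exchange_big; apply: eq_bigr => i _.
by rewrite mulr_sumr; apply: eq_bigr => x _; rewrite mulrA.
Qed.

Lemma dotpC f g : dotp g f = (dotp f g)^*.
Proof.
by rewrite rmorph_sum; apply: eq_bigr => x _; rewrite rmorphM /= conjCK mulrC.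
Qed.

Lemma dotpZl a f g : dotp (a *: f) g = a * dotp f g.
Proof. by rewrite mulr_sumr; apply: eq_bigr => x _; rewrite !ffunE mulrA. Qed.

Lemma dotpZr a f g : dotp f (a *: g) = a^* * dotp f g.
Proof. by rewrite dotpC dotpZl rmorphM /= -dotpC. Qed.

Lemma dotpDl f f' g : dotp (f + f') g = dotp f g + dotp f' g.
Proof. by rewrite -big_split; apply: eq_bigr => x _; rewrite !ffunE mulrDl. Qed.

Lemma normsqE f : normsq f = dotp f f.
Proof. by apply: eq_bigr => x _; rewrite normCK. Qed.

Definition orthonormal (I : finType) (b : I -> fn R T) :=
  forall i j, dotp (b i) (b j) = (i == j)%:R.

Lemma orthonormal_coord (I : finType) (b : I -> fn R T) (c : I -> R[i]) j :
  orthonormal b -> dotp (\sum_i c i *: b i) (b j) = c j.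
Proof.
move=> ob; rewrite dotp_suml (bigD1 j) //= ob eqxx mulr1 big1 ?addr0 // => i ij.
by rewrite ob (negPf ij) mulr0.
Qed.

(** Pairing a vanishing combination with [b i] returns its [i]-th coefficient, so independence is
    automatic and only the expansion of each [f] remains to be supplied. *)
Lemma orthonormal_onb (I : finType) P (b : I -> fn R T) :
    orthonormal b -> (forall i, P (b i)) ->
    (forall f, P f -> f = \sum_i dotp f (b i) *: b i) ->
  onb P b.
Proof.
move=> ob Pb Pf; split=> //; split=> //; split=> [c c0 i|f /Pf ->].
  rewrite -(orthonormal_coord c i ob) c0 /dotp big1 // => x _.
  by rewrite ffunE mul0r.
by eexists.
Qed.

Section Onb.
Variables (I : finType) (P : subsp R T) (b : I -> fn R T).
Hypothesis bP : onb P b.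

Lemma onb_expand f : P f -> f = \sum_i dotp f (b i) *: b i.
Proof.
case: bP => -[_ [_ Pspan]] ob /Pspan[c ->].
by apply: eq_bigr => i _; rewrite orthonormal_coord.
Qed.

Lemma onb_dotp f g :
  P f -> P g -> dotp f g = \sum_i dotp f (b i) * (dotp g (b i))^*.
Proof.
move=> /onb_expand {1}-> _; rewrite dotp_suml.
by apply: eq_bigr => i _; rewrite -(dotpC g).
Qed.

Lemma onb_ext (b' : I -> fn R T) : b =1 b' -> onb P b'.
Proof. by move=> /funext <-. Qed.

Lemma onb_reindex (J : finType) (h : J -> I) : bijective h -> onb P (b \o h).
Proof.
move=> bij_h; have [[Pb _] ob] := bP.
apply: orthonormal_onb => [i j|i|f Pf] /=; last 2 first.
- exact: Pb.
- by rewrite {1}(onb_expand Pf) (reindex h) //; apply: onW_bij.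
by rewrite ob (inj_eq (bij_inj bij_h)).
Qed.

End Onb.

Lemma is_basis_reindex (I J : finType) P (b : I -> fn R T) (h : J -> I) :
  bijective h -> is_basis P b -> is_basis P (b \o h).
Proof.
move=> [h' hK h'K] [Pb [indb spanb]]; split=> [i|]; first exact: Pb.
have rh (F : I -> fn R T) : \sum_i F i = \sum_j F (h j).
  by rewrite (reindex h) //; exists h' => ? _.
split=> [c c0 j|f /spanb[c ->]]; last first.
  by exists (c \o h); rewrite rh.
rewrite -(hK j); apply: (indb (c \o h')); rewrite rh -[RHS]c0.
by apply: eq_bigr => k _ /=; rewrite hK.
Qed.

Lemma is_basis_dim (I : finType) P (b : I -> fn R T) n :
  #|I| = n -> is_basis P b -> has_dim P n.
Proof.
by move=> <- bb; exists (b \o enum_val); apply: is_basis_reindex bb;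
  apply: enum_val_bij.
Qed.

(** Coefficients form a row vector acted on by [M] from the right: cancelling [M] gives
    independence, applying [invmx M] gives spanning. Stated for plain bases because it serves the
    translates of the Dirichlet kernel. *)
Lemma is_basis_mx n P (e : 'I_n -> fn R T) (M : 'M[R[i]]_n) :
    M \in unitmx -> is_basis P e ->
    (forall i, P (\sum_j M i j *: e j)) ->
  is_basis P (fun i => \sum_j M i j *: e j).
Proof.
move=> uM [_ [inde spane]] PM; split=> //.
have comb (c : 'rV[R[i]]_n) :
    \sum_i c 0 i *: (\sum_j M i j *: e j) = \sum_j (c *m M) 0 j *: e j.
  under eq_bigr do rewrite scaler_sumr.
  rewrite exchange_big; apply: eq_bigr => j _; rewrite mxE scaler_suml.
  by apply: eq_bigr => i _; rewrite scalerA.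
split=> [c c0 i|f /spane[c ->]].
  have: (\row_i c i) *m M = 0.
    apply/rowP => j; rewrite [RHS]mxE; apply: (inde (fun j => (_ *m M) 0 j)).
    by rewrite -comb -[RHS]c0; apply: eq_bigr => k _; rewrite mxE.
  move=> /(congr1 (mulmx^~ (invmx M))); rewrite mulmxK // mul0mx.
  by move=> /rowP/(_ i); rewrite !mxE.
exists (fun i => (\row_j c j *m invmx M) 0 i); rewrite comb mulmxKV //.
by apply: eq_bigr => j _; rewrite mxE.
Qed.

(* A square matrix with orthonormal rows is unitary, hence has orthonormal columns. *)
Lemma orthonormal_full (I : finType) (b : I -> fn R T) :
  #|I| = #|T| -> orthonormal b -> onb fullsp b.
Proof.
move=> cIT ob; apply: orthonormal_onb => // f _.
pose B := \matrix_(i < #|I|, x < #|I|) b (enum_val i) (enum_val (cast_ord cIT x)).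
have rT (F : T -> R[i]) :
    \sum_x F x = \sum_(x < #|I|) F (enum_val (cast_ord cIT x)).
  rewrite (reindex (fun x => enum_val (cast_ord cIT x))) //=.
  apply: onW_bij; apply: bij_comp; first exact: enum_val_bij.
  by exists (cast_ord (esym cIT)) => i; rewrite ?cast_ordK ?cast_ordKV.
have rI (F : I -> R[i]) : \sum_i F i = \sum_(i < #|I|) F (enum_val i).
  rewrite (reindex (fun i : 'I_#|I| => enum_val i)) //.
  by apply: onW_bij; apply: enum_val_bij.
have BB : B *m (map_mx Num.conj B)^T = 1%:M.
  apply/matrixP=> i j; rewrite !mxE -(inj_eq enum_val_inj) -ob /dotp rT.
  by apply: eq_bigr => x _; rewrite !mxE.
have /matrixP BB' := mulmx1C BB.
have bb x y : \sum_i (b i x)^* * b i y = (x == y)%:R.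
  have := BB' (cast_ord (esym cIT) (enum_rank x)) (cast_ord (esym cIT) (enum_rank y)).
  rewrite !mxE (inj_eq (@cast_ord_inj _ _ _)) (inj_eq enum_rank_inj) => <-.
  rewrite rI; apply: eq_bigr => i _; rewrite !mxE !cast_ordKV.
  by rewrite !enum_rankK.
apply/ffunP => y; rewrite fn_sumE; under eq_bigr do rewrite mulr_suml.
rewrite exchange_big (bigD1 y) //= [X in _ + X]big1 ?addr0 => [|x xy].
  under eq_bigr do rewrite -mulrA.
  by rewrite -mulr_sumr bb eqxx mulr1.
under eq_bigr do rewrite -mulrA.
by rewrite -mulr_sumr bb (negPf xy) mulr0.
Qed.

(** * Subspaces cut out by sets of basis indices *)

Section CoordinateSubspace.
Variables (I : finType) (b : I -> fn R T).
Hypothesis bT : onb fullsp b.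

(** Vanishing coordinates are used instead of a span, so that membership is tested index by index
    and relations between subspaces become relations between index sets. *)
Definition coordsp (A : pred I) : subsp R T :=
  fun f => forall i, ~~ A i -> dotp f (b i) = 0.

Lemma coordsp_sum (A : pred I) f :
  coordsp A f -> f = \sum_(i | A i) dotp f (b i) *: b i.
Proof.
move=> Af; rewrite {1}(onb_expand bT (f := f)) // (bigID A) /= [X in _ + X]big1.
  by rewrite addr0.
by move=> i nAi; rewrite Af // scale0r.
Qed.

Lemma coordsp_comb (A : pred I) (J : Type) (r : seq J) (Q : pred J)
  (c : J -> R[i]) (v : J -> fn R T) :
  (forall j, Q j -> coordsp A (v j)) -> coordsp A (\sum_(j <- r | Q j) c j *: v j).
Proof.
move=> Av i nAi; rewrite dotp_suml big1 // => j Qj.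
by rewrite Av ?mulr0.
Qed.

Lemma coordsp_basis_vec (A : pred I) i : A i -> coordsp A (b i).
Proof.
move=> Ai j; case: bT => _ ->; case: eqVneq => // <-.
by rewrite Ai.
Qed.

(** The free index type [J] lets a subspace receive a basis indexed by whatever type is convenient,
    with [h] enumerating [A] without repetition. *)
Lemma coordsp_onb (J : finType) (A : pred I) (h : J -> I) :
    injective h -> (forall j, A (h j)) -> (forall i, A i -> exists j, h j = i) ->
  onb (coordsp A) (b \o h).
Proof.
move=> inj_h Ah hA; have [_ ob] := bT.
apply: orthonormal_onb => [i j|j|f Af] /=.
- by rewrite ob (inj_eq inj_h).
- exact: coordsp_basis_vec.
rewrite {1}(coordsp_sum Af).
have inA i : A i = (i \in [set h j | j in J]).
  apply/idP/imsetP => [/hA[j <-]|[j _ ->]]; by [exists j | apply: Ah].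
rewrite (eq_bigl _ _ inA) big_imset /=; last by move=> ? ? _ _; apply: inj_h.
by apply: eq_bigl.
Qed.

(** An orthogonal decomposition is a partition of the index set. For orthogonality, every term of
    the coordinate formula for the inner product has a zero factor; for the sum, the expansion of
    [f] is cut into three partial sums. *)
Lemma coordsp_odsum3 (P A B C : pred I) :
    (forall i, P i = [|| A i, B i | C i]) ->
    (forall i, A i -> ~~ B i) -> (forall i, A i -> ~~ C i) ->
    (forall i, B i -> ~~ C i) ->
  odsum3 (coordsp P) (coordsp A) (coordsp B) (coordsp C).
Proof.
move=> PE AB AC BC.
have orth (A1 A2 : pred I) a1 a2 : (forall i, A1 i -> ~~ A2 i) ->
    coordsp A1 a1 -> coordsp A2 a2 -> dotp a1 a2 = 0.
  move=> A12 Aa1 Aa2; rewrite (onb_dotp bT) // big1 // => i _.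
  have [/A12/Aa2 ->|/Aa1 ->] := boolP (A1 i); last by rewrite mul0r.
  by rewrite conjC0 mulr0.
split; last first.
  by split; [|split] => a c;
    [apply: orth AB | apply: orth AC | apply: orth BC].
move=> f; split=> [Pf|[a [c [d [Aa Bc Cd ->]]]] i].
  exists (\sum_(i | A i) dotp f (b i) *: b i).
  exists (\sum_(i | B i) dotp f (b i) *: b i).
  exists (\sum_(i | C i) dotp f (b i) *: b i).
  split; try by apply: coordsp_comb => i; apply: coordsp_basis_vec.
  rewrite {1}(coordsp_sum Pf) (bigID A) -addrA; congr (_ + _).
    by apply: eq_bigl => i; rewrite PE; case: (A i); rewrite ?andbF.
  rewrite (bigID B); congr (_ + _); apply: eq_bigl => i; rewrite PE.
    by case: (A i) (AB i) => [/(_ isT)/negPf->|]; case: (B i); rewrite ?andbF.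
  case: (A i) (AC i) => /= [/(_ isT)/negPf->//|_].
  by case: (B i) (BC i) => /= [/(_ isT)/negPf->|_]; rewrite ?andbT.
rewrite PE !negb_or => /and3P[nA nB nC].
by rewrite !dotpDl Aa // Bc // Cd // !addr0.
Qed.

End CoordinateSubspace.

(** * Eigenspaces and Paley-Wiener spaces from an orthonormal eigenbasis *)

Section Spectrum.
Variables (adj : rel T) (I : finType) (b : I -> fn R T) (mu : I -> R).
Hypothesis bT : onb fullsp b.
Hypothesis b_eig : forall i, lap adj (b i) = (mu i)%:C *: b i.

Lemma lap_comb (J : Type) (r : seq J) (Q : pred J)
  (c : J -> R[i]) (v : J -> fn R T) :
  lap adj (\sum_(j <- r | Q j) c j *: v j) = \sum_(j <- r | Q j) c j *: lap adj (v j).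
Proof.
apply/ffunP => x; rewrite ffunE.
under eq_bigr do rewrite !fn_sumE -sumrB.
rewrite exchange_big fn_sumE; apply: eq_bigr => j _; rewrite ffunE mulr_sumr.
by apply: eq_bigr => y _; rewrite mulrBr.
Qed.

Lemma lap_coord f i : dotp (lap adj f) (b i) = (mu i)%:C * dotp f (b i).
Proof.
have [_ ob] := bT.
rewrite {1}(onb_expand bT (f := f)) // lap_comb.
under eq_bigr do rewrite b_eig scalerA.
by rewrite orthonormal_coord // mulrC.
Qed.

(** The [i]-th coordinate of the eigenvalue equation says that [lam - mu i] times the coordinate of
    [f] is zero. *)
Lemma eigsp_coordsp lam :
  eigsp adj lam = coordsp b (fun i => mu i == lam).
Proof.
apply: funext => f; apply: propext; split=> [Ef i mui|Af].
  have /eqP := lap_coord f i; rewrite Ef dotpZl -subr_eq0 -mulrBl mulf_eq0.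
  by rewrite subr_eq0 (inj_eq (@complexI _)) eq_sym (negPf mui) => /eqP.
rewrite /eigsp {1 2}(coordsp_sum bT Af) lap_comb scaler_sumr.
by apply: eq_bigr => i /eqP mui; rewrite b_eig mui !scalerA mulrC.
Qed.

(** An eigenvector for [nu <= lam] has coordinates only where [mu i = nu], by [eigsp_coordsp].
    Conversely the expansion of [f] over the admissible indices is itself a finite combination of
    eigenvectors. *)
Lemma PW_coordsp lam : PW adj lam = coordsp b (fun i => mu i <= lam).
Proof.
have [_ ob] := bT.
apply: funext => f; apply: propext; split=> [[n [c [v [vle ->]]]]|Af].
  apply: coordsp_comb => j _ i; rewrite -ltNge => lam_lt.
  have [_ [nu [nu_le /esym Ev]]] := vle j.
  move: Ev; rewrite -/(eigsp adj nu (v j)) => /esym.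
  rewrite -/(eigsp adj nu (v j)) eigsp_coordsp; apply.
  by rewrite gt_eqF // (le_lt_trans nu_le).
pose A := [pred i | mu i <= lam].
exists #|A|, (fun i => dotp f (b (enum_val i))), (fun i => b (enum_val i)).
split=> [i|]; last first.
  rewrite {1}(coordsp_sum bT Af).
  exact: (big_enum_val (A := A) (fun i => dotp f (b i) *: b i)).
split; last by exists (mu (enum_val i)); split; [exact: (enum_valP i)|].
(* Eigenvectors must be nonzero, which follows from the unit norm. *)
apply/eqP => b0; have := ob (enum_val i) (enum_val i).
rewrite b0 eqxx /dotp big1 => [/esym/eqP|x _]; last by rewrite ffunE mul0r.
by rewrite oner_eq0.
Qed.

End Spectrum.

End LinearAlgebra.

(** * Tensor products of bases and the Laplacian of a Cartesian product *)

Section Tensor.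
Variables (R : realType) (T1 T2 : finType).
Implicit Types (V : subsp R T1) (W : subsp R T2).

Lemma dotp_tens (g g' : fn R T1) (h h' : fn R T2) :
  dotp (tens g h) (tens g' h') = dotp g g' * dotp h h'.
Proof.
rewrite /dotp big_distrlr pair_bigA; apply: eq_bigr => -[x y] _ /=.
by rewrite !ffunE rmorphM /= mulrACA.
Qed.

Lemma tens_sum (I J : finType) (c : I -> R[i]) (d : J -> R[i])
  (g : I -> fn R T1) (h : J -> fn R T2) :
  tens (\sum_i c i *: g i) (\sum_j d j *: h j) =
  \sum_p (c p.1 * d p.2) *: tens (g p.1) (h p.2).
Proof.
apply/ffunP => x; rewrite ffunE !fn_sumE big_distrlr pair_bigA.
by apply: eq_bigr => -[i j] _; rewrite ffunE /= mulrACA.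
Qed.

Lemma tens_is_basis (I J : finType) V W (g : I -> fn R T1) (h : J -> fn R T2) :
    is_basis V g -> is_basis W h ->
  is_basis (tens_sp V W) (fun p : I * J => tens (g p.1) (h p.2)).
Proof.
move=> [Vg [indg spang]] [Wh [indh spanh]]; split=> [[i j]|].
  exists 1%N, (fun=> g i), (fun=> h j); split=> [_|]; first by split.
  by rewrite big_ord1.
split=> [c c0 [i j]|f [n [g' [h' [gh' ->]]]]].
  (* Independence is used one factor at a time: for [h] with [i] fixed, then for [g] with the point
     [y] of the second graph fixed. *)
  apply: (indh (fun j => c (i, j))); apply/ffunP => y.
  rewrite fn_sumE [RHS]ffunE.
  apply: (indg (fun i => \sum_j c (i, j) * h j y)); apply/ffunP => x.
  rewrite fn_sumE [RHS]ffunE.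
  have /ffunP/(_ (x, y)) := c0; rewrite fn_sumE [RHS]ffunE => c0xy.
  rewrite -[RHS]c0xy.
  under eq_bigr do rewrite /= mulr_suml.
  rewrite pair_bigA; apply: eq_bigr => -[k l] _ /=.
  by rewrite ffunE /= mulrAC -mulrA.
have /fin_all_exists[cg cgE] := fun k => spang _ (gh' k).1.
have /fin_all_exists[ch chE] := fun k => spanh _ (gh' k).2.
exists (fun p => \sum_k cg k p.1 * ch k p.2).
under eq_bigr do rewrite cgE chE tens_sum.
by rewrite exchange_big; apply: eq_bigr => p _; rewrite scaler_suml.
Qed.

Lemma tens_onb (I J : finType) V W (g : I -> fn R T1) (h : J -> fn R T2) :
    onb V g -> onb W h ->
  onb (tens_sp V W) (fun p : I * J => tens (g p.1) (h p.2)).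
Proof.
move=> [Vg og] [Wh oh]; split; first exact: tens_is_basis.
by move=> [i j] [i' j']; rewrite dotp_tens og oh -natrM mulnb.
Qed.

Lemma delta_onb (T : finType) :
  onb (@fullsp R T) (fun j => [ffun l => (l == j)%:R]).
Proof.
have dE (f : fn R T) j : dotp f [ffun l => (l == j)%:R] = f j.
  rewrite /dotp (bigD1 j) //= ffunE eqxx conjC1 mulr1 big1 ?addr0 // => l lj.
  by rewrite ffunE (negPf lj) conjC0 mulr0.
apply: orthonormal_onb => // [i j|f _]; first by rewrite dE ffunE eq_sym.
apply/ffunP => x; rewrite fn_sumE (bigD1 x) //= dE ffunE eqxx mulr1.
by rewrite big1 ?addr0 // => y yx; rewrite ffunE eq_sym (negPf yx) mulr0.
Qed.

(** Any [f] is the sum, over the points of [T1], of a point mass tensored with the corresponding row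
    of [f]. *)
Lemma tens_sp_full : tens_sp fullsp fullsp = @fullsp R (T1 * T2)%type.
Proof.
apply: funext => f; apply: propext; split=> // _.
pose g (i : 'I_#|T1|) : fn R T1 := [ffun l => (l == enum_val i)%:R].
exists #|T1|, g, (fun i => [ffun l => f (enum_val i, l)]); split=> //.
apply/ffunP => -[x y]; rewrite sum_ffunE (bigD1 (enum_rank x)) //= big1.
  by rewrite !ffunE /= enum_rankK eqxx mul1r addr0.
move=> i; rewrite !ffunE /=; case: (x =P enum_val i) => [->|]; last by rewrite mul0r.
by rewrite enum_valK eqxx.
Qed.

Lemma tens_coordsp (I J : finType) (g : I -> fn R T1) (h : J -> fn R T2)
    (A : pred I) (B : pred J) :
    onb fullsp g -> onb fullsp h ->
  tens_sp (coordsp g A) (coordsp h B) =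
  coordsp (fun p => tens (g p.1) (h p.2)) (fun p => A p.1 && B p.2).
Proof.
move=> og oh; have ogh := tens_onb og oh; rewrite tens_sp_full in ogh.
apply: funext => f; apply: propext; split=> [[n [g' [h' [gh' ->]]]]|Af].
  under eq_bigr do rewrite -[tens _ _]scale1r.
  apply: coordsp_comb => k _ [i j]; rewrite dotp_tens negb_and /=.
  by have [Ag Bh] := gh' k; move=> /orP[/Ag|/Bh] ->; rewrite ?mul0r ?mulr0.
pose AB := [pred p : I * J | A p.1 && B p.2].
pose b p := tens (g p.1) (h p.2).
(* A term of [tens_sp] carries no scalar, so the coefficient is absorbed into the first factor. *)
exists #|AB|, (fun k => dotp f (b (enum_val k)) *: g (enum_val k).1).
exists (fun k => h (enum_val k).2); split=> [k|].
  have /andP[Ak Bk] := enum_valP k; split; last exact: coordsp_basis_vec.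
  by move=> i nAi; rewrite dotpZl (coordsp_basis_vec og Ak) ?mulr0.
rewrite {1}(coordsp_sum ogh Af) (big_enum_val (A := AB)); apply: eq_bigr => k _.
by apply/ffunP => x; rewrite !ffunE /=; apply: mulrA.
Qed.

(** The neighbours of [(x, y)] split into those that move [x] and those that move [y]; irreflexivity
    of [a1] keeps the two classes disjoint. *)
Lemma lap_tens (a1 : rel T1) (a2 : rel T2) (g : fn R T1) (h : fn R T2) :
  irreflexive a1 ->
  lap (box_adj a1 a2) (tens g h) = tens (lap a1 g) h + tens g (lap a2 h).
Proof.
move=> irr1; apply/ffunP => -[x y].
rewrite !ffunE (bigID (fun q : T1 * T2 => a1 x q.1 && (y == q.2))) /=.
rewrite mulr_suml mulr_sumr; congr (_ + _).
  transitivity (\sum_(p | a1 x p.1 && (y == p.2)) (g x - g p.1) * h p.2).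
    apply: eq_big => [[u v]|[u v] /andP[_ /andP[_ /eqP/= <-]]]; last first.
      by rewrite !ffunE /= -mulrBl.
    by rewrite /box_adj /=; case: (a1 x u); case: (y == v); rewrite /= ?andbF.
  rewrite -(pair_big (a1 x) (eq_op y) (fun u v => (g x - g u) * h v)) /=.
  by apply: eq_bigr => u _; rewrite (big_pred1 y) // => v; rewrite eq_sym.
transitivity (\sum_(p | (x == p.1) && a2 y p.2) g p.1 * (h y - h p.2)).
  apply: eq_big => [[u v]|[u v]]; rewrite /box_adj /=.
    by case: (eqVneq x u) => [<-|_]; rewrite ?irr1 /= ?orbF ?andbT ?andbN.
  case: (eqVneq x u) => [<- _|_]; last by rewrite orbF andbN.
  by rewrite !ffunE /= -mulrBr.
rewrite -(pair_big (eq_op x) (a2 y) (fun u v => g u * (h y - h v))) /=.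
by rewrite (big_pred1 x) // => u; rewrite eq_sym.
Qed.

End Tensor.

(** * The operator Q and Parseval's identity on the slice at 0 *)

Section Slice.
Variables (R : realType) (N m : nat).
Implicit Types f : fn R ('rV['Z_2]_N * 'Z_m)%type.

Definition slice f : fn R 'rV['Z_2]_N := [ffun u => f (u, 0)].

Lemma sum_slice (F : 'rV['Z_2]_N * 'Z_m -> R[i]) :
  (forall p, p.2 != 0 -> F p = 0) -> \sum_p F p = \sum_u F (u, 0).
Proof.
move=> F0; transitivity (\sum_p F (p.1, p.2)); first by apply: eq_bigr => -[].
rewrite -(pair_bigA _ (fun u l => F (u, l))) /=; apply: eq_bigr => u _.
by rewrite (bigD1 0) //= big1 ?addr0 // => l l0; rewrite F0.
Qed.

Lemma normsq_Qop f : normsq (Qop N m f) = normsq (slice f).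
Proof.
rewrite /normsq sum_slice => [|p p0]; last first.
  by rewrite ffunE (negPf p0) normr0 expr0n.
by apply: eq_bigr => u _; rewrite !ffunE eqxx.
Qed.

Lemma dotp_Qop f (w : 'Z_m -> R[i]) (g : fn R 'rV['Z_2]_N) :
  dotp (Qop N m f) [ffun p => w p.2 * g p.1] = (w 0)^* * dotp (slice f) g.
Proof.
rewrite /dotp sum_slice => [|p p0]; last by rewrite ffunE (negPf p0) mul0r.
rewrite mulr_sumr; apply: eq_bigr => u _; rewrite !ffunE eqxx rmorphM /=.
by rewrite mulrCA.
Qed.

(** At cycle coordinate 0 a pure tensor restricts to a scalar multiple of its cube factor, so the
    slice lies in the span of [g] for any [W]. All three norm identities are instances, with [w] the
    point mass, the Dirichlet kernel or a constant. *)
Lemma Qop_parseval (I : finType) V W (g : I -> fn R 'rV['Z_2]_N)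
    (w : 'Z_m -> R[i]) f :
    onb V g -> tens_sp V W f ->
  \sum_i `|dotp (Qop N m f) [ffun p => w p.2 * g i p.1]| ^+ 2 =
  `|w 0| ^+ 2 * normsq (Qop N m f).
Proof.
move=> oV [n [g' [h' [gh' fE]]]].
have sE : exists c : I -> R[i], slice f = \sum_i c i *: g i.
  exists (fun i => \sum_k h' k 0 * dotp (g' k) (g i)).
  apply/ffunP => u; rewrite ffunE fE sum_ffunE fn_sumE.
  under [RHS]eq_bigr do rewrite mulr_suml.
  rewrite exchange_big; apply: eq_bigr => k _; rewrite ffunE /= mulrC.
  rewrite {1}(onb_expand oV (gh' k).1) fn_sumE mulr_sumr.
  by apply: eq_bigr => i _; rewrite mulrA.
have [[_ og] [c cE]] := (oV, sE).
rewrite normsq_Qop normsqE {1}cE dotp_suml mulr_sumr; apply: eq_bigr => i _.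
have ci : dotp (slice f) (g i) = c i by rewrite cE orthonormal_coord.
by rewrite dotp_Qop (dotpC _ (g i)) ci -normCK normrM norm_conjC exprMn.
Qed.

End Slice.

(** * The eigenbasis of the Boolean cube *)

Section Cube.
Variables (R : realType).

(** Both sides share the degree term; the remaining sums over adjacent pairs agree after exchanging
    the endpoints. *)
Lemma lap_selfadjoint (T : finType) (adj : rel T) (f g : fn R T) :
  symmetric adj -> dotp (lap adj f) g = dotp f (lap adj g).
Proof.
move=> sym; rewrite /dotp.
have L x : lap adj f x * (g x)^* =
    \sum_(y | adj x y) f x * (g x)^* - \sum_(y | adj x y) f y * (g x)^*.
  by rewrite ffunE mulr_suml -sumrB; apply: eq_bigr => y _; rewrite mulrBl.
have L' x : f x * (lap adj g x)^* =
    \sum_(y | adj x y) f x * (g x)^* - \sum_(y | adj x y) f x * (g y)^*.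
  rewrite ffunE rmorph_sum mulr_sumr -sumrB.
  by apply: eq_bigr => y _; rewrite rmorphB mulrBr.
under eq_bigr do rewrite L; under [RHS]eq_bigr do rewrite L'.
rewrite !sumrB; congr (_ - _).
rewrite (exchange_big_dep xpredT) //=; apply: eq_bigr => x _.
by apply: eq_bigl => y; rewrite sym.
Qed.

Lemma conjC_real_complex (r : R) : (r%:C)^* = r%:C.
Proof. exact: conjc_real. Qed.

Lemma eigsp_orth (T : finType) (adj : rel T) (lam nu : R) (f g : fn R T) :
  symmetric adj -> lam != nu -> eigsp adj lam f -> eigsp adj nu g -> dotp f g = 0.
Proof.
move=> sym neq Ef Eg; have /eqP := lap_selfadjoint f g sym.
rewrite Ef Eg dotpZl dotpZr conjC_real_complex -subr_eq0 -mulrBl mulf_eq0 subr_eq0.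
by rewrite (inj_eq (@complexI _)) (negPf neq) => /eqP.
Qed.

Lemma cube_adj_sym N : symmetric (cube_adj N).
Proof.
suff sub v w : cube_adj N v w -> cube_adj N w v by move=> v w; apply/idP/idP; apply: sub.
move=> /existsP[i /eqP vw]; apply/existsP; exists i; apply/eqP.
rewrite -opprB vw; apply/matrixP => x y; rewrite !mxE.
(* In [Z_2] both 0 and 1 are their own opposites. *)
by case: (_ && _); apply/eqP.
Qed.

Lemma cube_adj_irr N : irreflexive (cube_adj N).
Proof.
move=> v; apply/existsP => -[i /eqP]; rewrite subrr => /matrixP/(_ 0 i)/eqP.
by rewrite !mxE !eqxx.
Qed.

Lemma card_sig_ord n (F : nat -> nat) :
  #|{: {k : 'I_n & 'I_(F k)}}| = (\sum_(k < n) F k)%N.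
Proof.
rewrite card_tagged sumnE big_map big_enum.
by apply: eq_bigr => k _; rewrite card_ord.
Qed.

Variables (N : nat) (psi : forall k : nat, 'I_('C(N, k)) -> fn R 'rV['Z_2]_N).
Arguments psi : clear implicits.
Hypothesis psi_onb :
  forall k, (k <= N)%N -> onb (eigsp (cube_adj N) (2 * k%:R)) (psi k).

(** The sigma type reflects that the range of nu depends on kappa. The bound [n] keeps the levels
    kappa < n: [N.+1] gives the whole space, [K.-1] the levels of space (i). *)
Definition cube_vec (n : nat) (x : {k : 'I_n & 'I_('C(N, k))}) :=
  psi (tag x) (tagged x).

Lemma cube_vec_eig (x : {k : 'I_N.+1 & 'I_('C(N, k))}) :
  lap (cube_adj N) (cube_vec x) = (2 * (tag x)%:R : R)%:C *: cube_vec x.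
Proof. by have [[Pb _] _] := psi_onb (ltn_ord (tag x)); apply: Pb. Qed.

(** Distinct levels are orthogonal since their eigenvalues differ, and the binomial expansion of (1
    + 1)^N matches the number of vectors with the number of vertices. No eigenvector of the cube is
    computed. *)
Lemma cube_vec_onb : onb fullsp (@cube_vec N.+1).
Proof.
apply: orthonormal_full => [|x y].
  rewrite card_sig_ord card_mx mul1n card_ord -[2%N in RHS]/(1 + 1)%N expnDn.
  by apply: eq_bigr => k _; rewrite !exp1n !muln1.
have [kx_ky|neq] := eqVneq (tag x) (tag y); last first.
  rewrite (eigsp_orth (cube_adj_sym (N := N)) _ (cube_vec_eig x) (cube_vec_eig y)).
    by case: (x =P y) neq => // ->; rewrite eqxx.
  by rewrite (inj_eq (mulfI _)) ?pnatr_eq0 // eqr_nat.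
case: x y kx_ky => [k i] [k' j] /= kk'; case: k' / kk' j => j.
have [_ ob] := psi_onb (ltn_ord k : (k <= N)%N); rewrite ob.
by rewrite -tag_eqE /tag_eq eqxx /= tagged_asE.
Qed.

Lemma cube_vec_sub_onb n (A : pred {k : 'I_N.+1 & 'I_('C(N, k))}) :
    (n <= N.+1)%N -> (forall x, A x = (tag x < n)%N) ->
  onb (coordsp (@cube_vec N.+1) A) (@cube_vec n).
Proof.
move=> nN AE.
pose h (x : {k : 'I_n & 'I_('C(N, k))}) : {k : 'I_N.+1 & 'I_('C(N, k))} :=
  existT (fun k : 'I_N.+1 => 'I_('C(N, k))) (widen_ord nN (tag x)) (tagged x).
apply: (coordsp_onb cube_vec_onb (h := h)) => [[k i] [k' j]|x|[[k kN] i]].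
- move=> E; have kk' : k = k' by apply/val_inj; have /(congr1 (val \o tag)) := E.
  case: k' / kk' j E => j /eqP; rewrite -tag_eqE /tag_eq eqxx /= tagged_asE.
  by move=> /eqP ->.
- by rewrite AE /=.
rewrite AE /= => kn.
exists (existT (fun k : 'I_n => 'I_('C(N, k))) (Ordinal kn) i).
(* The two indices differ only in the proof of the bound on [k]; quantifying over both proofs lets
   the rewriting pass under the dependent type. *)
have irr (p q : (k < N.+1)%N) (j : 'I_('C(N, k))) :
    existT (fun k : 'I_N.+1 => 'I_('C(N, k))) (Ordinal p) j =
    existT (fun k : 'I_N.+1 => 'I_('C(N, k))) (Ordinal q) j.
  by rewrite (bool_irrelevance p q).
exact: irr.
Qed.

End Cube.

(** * Characters and spectrum of the cycle *)

Section Cycle.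
Variable R : realType.
Implicit Types s t : R.

Lemma sqrtM_nat n :
  (Num.sqrt (n%:R : R))%:C * (Num.sqrt (n%:R : R))%:C = n%:R :> R[i].
Proof. by rewrite -rmorphM -expr2 sqr_sqrtr ?ler0n // rmorph_nat. Qed.

Lemma sqrt_nat_neq0 n : (0 < n)%N -> (Num.sqrt (n%:R : R))%:C != 0 :> R[i].
Proof.
by move=> n0; rewrite (inj_eq (@complexI _) _ 0) sqrtr_eq0 -ltNge ltr0n.
Qed.

Lemma expi0 : expi 0 = 1 :> R[i].
Proof. by rewrite /expi cos0 sin0. Qed.

Lemma expiD s t : expi (s + t) = expi s * expi t.
Proof.
rewrite /expi cosD sinD; apply/eqP; rewrite eq_complex /=.
by rewrite eqxx /= addrC.
Qed.

Lemma expiMn t n : expi (t * n%:R) = expi t ^+ n.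
Proof.
elim: n => [|n IHn]; first by rewrite mulr0 expi0.
by rewrite -natr1 mulrDr mulr1 expiD IHn exprSr.
Qed.

Lemma conj_expi t : (expi t)^* = expi (- t).
Proof. by rewrite /expi cosN sinN. Qed.

Lemma expi_conjM t : expi t * (expi t)^* = 1.
Proof. by rewrite conj_expi -expiD subrr expi0. Qed.

Lemma expi2pi : expi (2 * pi) = 1 :> R[i].
Proof. by rewrite /expi mulr_natl cos2pi sin2pi. Qed.

Variable m : nat.
Hypothesis m_ge3 : (3 <= m)%N.

Let m_gt1 : (1 < m)%N. Proof. exact: leq_trans m_ge3. Qed.
Let m_gt0 : (0 < m)%N. Proof. exact: leq_trans m_ge3. Qed.
Let m_neq0 : m%:R != 0 :> R. Proof. by rewrite pnatr_eq0 -lt0n. Qed.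

Lemma Zp_m_eq0 : m%:R = 0 :> 'Z_m.
Proof. by apply: val_inj; rewrite /= val_Zp_nat // modnn. Qed.

(** The exponent is the representative of [k] in [0, m); by [chi_nat] any other natural
    representative gives the same value. *)
Definition chi (k : 'Z_m) : R[i] := expi (2 * pi / m%:R) ^+ k.

Lemma expi_unity_root : expi (2 * pi / m%:R) ^+ m = 1 :> R[i].
Proof. by rewrite -expiMn mulfVK ?expi2pi. Qed.

Lemma chi_nat n : chi n%:R = expi (2 * pi / m%:R) ^+ n.
Proof. by rewrite /chi val_Zp_nat // expr_mod // expi_unity_root. Qed.

Lemma chiD k l : chi (k + l) = chi k * chi l.
Proof. by rewrite -[k]natr_Zp -[l]natr_Zp -natrD !chi_nat exprD. Qed.

Lemma chi0 : chi 0 = 1.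
Proof. by rewrite /chi expr0. Qed.

Lemma chi_conjM k : chi k * (chi k)^* = 1.
Proof. by rewrite /chi -expiMn expi_conjM. Qed.

Lemma chiN k : chi (- k) = (chi k)^*.
Proof.
by rewrite -[LHS]mulr1 -(chi_conjM k) mulrA -chiD addNr chi0 mul1r.
Qed.

Lemma chi_natM k n : chi (k * n%:R) = chi k ^+ n.
Proof. by rewrite -[k]natr_Zp -natrM !chi_nat exprM. Qed.

Lemma chi_Re_nat n : complex.Re (chi n%:R) = cos (2 * (pi * n%:R / m%:R)).
Proof. by rewrite chi_nat -expiMn /=; congr cos; field. Qed.

Definition cyc_eig (k : 'Z_m) : R := 4 * sin (pi * k%:R / m%:R) ^+ 2.

(** By the double-angle formula; bounds on eigenvalues thereby become signs of real parts of roots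
    of unity. *)
Lemma cyc_eigE k : cyc_eig k = 2 - 2 * complex.Re (chi k).
Proof.
rewrite -[k in RHS]natr_Zp chi_Re_nat [2 * (_ / _)]mulr_natl cos_mulr2n cos2sin2 /cyc_eig.
by ring.
Qed.

Lemma cyc_eig_ge0 k : 0 <= cyc_eig k.
Proof. by rewrite mulr_ge0 // sqr_ge0. Qed.

Lemma cyc_eig_le4 k : cyc_eig k <= 4.
Proof.
by rewrite /cyc_eig sin2cos2 -[leRHS]mulr1 ler_pM2l // lerBlDr lerDl sqr_ge0.
Qed.

(** For 0 < k < m the angle pi k / m lies strictly between 0 and pi, where the sine is positive. *)
Lemma cyc_eig_eq0 k : (cyc_eig k == 0) = (k == 0).
Proof.
rewrite mulf_eq0 pnatr_eq0 /= sqrf_eq0.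
apply/eqP/eqP => [sin_k0|->]; last by rewrite mulr0 mul0r sin0.
apply/val_inj; apply/eqP; rewrite /= eqn0Ngt; apply/negP => k0.
have := ltn_ord k; rewrite [X in (_ < X)%N](Zp_cast m_gt1) => km.
have : 0 < (pi : R) * (k : nat)%:R / m%:R < pi; last first.
  by move=> /sin_gt0_pi; rewrite sin_k0 ltxx.
rewrite divr_gt0 ?mulr_gt0 ?pi_gt0 ?ltr0n //=.
by rewrite ltr_pdivrMr ?ltr0n // ltr_pM2l ?pi_gt0 // ltr_nat.
Qed.

Lemma chi_eq1 k : chi k = 1 -> k = 0.
Proof. by move=> k1; apply/eqP; rewrite -cyc_eig_eq0 cyc_eigE k1 mulr1 subrr. Qed.

Lemma chi_inj : injective chi.
Proof.
move=> k l kl; apply/eqP; rewrite -subr_eq0; apply/eqP/chi_eq1.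
by rewrite chiD chiN kl chi_conjM.
Qed.

Lemma sum_chi k : \sum_l chi (k * l) = (m * (k == 0))%:R.
Proof.
have [->|k0] := eqVneq; rewrite ?muln1 ?muln0.
  under eq_bigr do rewrite mul0r chi0.
  by rewrite sumr_const card_ord Zp_cast.
(* Shifting [l] by 1 permutes the terms and multiplies the sum by [chi k], which differs from 1. *)
apply/eqP; have : (chi k - 1) * (\sum_l chi (k * l)) = 0.
  apply/eqP; rewrite mulrBl mul1r subr_eq0 mulr_sumr.
  rewrite [eqbRHS](reindex (fun l => l + 1)) /=.
    by apply/eqP/eq_bigr => l _; rewrite mulrDr mulr1 addrC chiD.
  by apply: onW_bij; exists (fun l => l - 1) => l; rewrite ?addrK ?subrK.
move=> /eqP; rewrite mulf_eq0 subr_eq0 => /orP[/eqP/chi_eq1/eqP|//].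
by rewrite (negPf k0).
Qed.

Definition fourier (k : 'Z_m) : fn R 'Z_m :=
  [ffun l => (Num.sqrt (m%:R : R))^-1%:C * chi (k * l)].

Lemma fourier_onb : onb fullsp fourier.
Proof.
apply: orthonormal_full => // k k'; rewrite /dotp.
transitivity ((m%:R)^-1 * \sum_l chi ((k - k') * l) : R[i]).
  rewrite mulr_sumr; apply: eq_bigr => l _; rewrite !ffunE rmorphM /=.
  by rewrite mulrACA mulrBl chiD chiN conjC_real_complex fmorphV -invfM sqrtM_nat.
rewrite sum_chi subr_eq0; case: eqP => _; rewrite ?muln1 ?muln0 ?mulr0 //.
by rewrite mulVf // pnatr_eq0 -lt0n.
Qed.

Lemma fourier_eig k : lap (cycle_adj m) (fourier k) = (cyc_eig k)%:C *: fourier k.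
Proof.
apply/ffunP => l; rewrite !ffunE /cycle_adj.
(* Here [m >= 3] matters: the two neighbours are distinct, so both contribute to the Laplacian. *)
have two_neq0 : l + 1 != l - 1.
  rewrite (inj_eq (addrI l)) -subr_eq0 opprK -(natrD _ 1 1).
  apply/eqP => /(congr1 (@nat_of_ord _)).
  by rewrite val_Zp_nat // modn_small.
rewrite (bigID (pred1 (l + 1))) /= (big_pred1 (l + 1)) => [|w]; last first.
  by rewrite /=; case: (w =P l + 1); rewrite ?andbF.
rewrite (big_pred1 (l - 1)) => [|w]; last first.
  by rewrite /=; case: (w =P l + 1) => [->|]; rewrite ?(negPf two_neq0) ?andbT.
rewrite !ffunE !mulrDr mulrN mulr1 !chiD chiN.
have -> : (cyc_eig k)%:C = 2 - (chi k + (chi k)^*).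
  by rewrite cyc_eigE addcJ rmorphB rmorphM rmorph_nat.
set c := _^-1%:C; rewrite -[RHS]/(_ * _); ring.
Qed.

Lemma zero_eigsp_cycle_onb :
  onb (eigsp (cycle_adj m) 0)
      (fun _ : unit => [ffun=> (Num.sqrt (m%:R : R))^-1%:C]).
Proof.
rewrite (eigsp_coordsp fourier_onb fourier_eig).
apply: (onb_ext (b := fourier \o (fun _ : unit => 0))).
  apply: coordsp_onb => [|[] [] //|_|k]; first exact: fourier_onb.
    by rewrite cyc_eig_eq0.
  by rewrite cyc_eig_eq0 => /eqP ->; exists tt.
by move=> x; apply/ffunP => l; rewrite !ffunE mul0r chi0 mulr1.
Qed.

Lemma cyc_eig_le2 k : (cyc_eig k <= 2) = (0 <= complex.Re (chi k)).
Proof. by rewrite cyc_eigE lerBlDr lerDl pmulr_rge0. Qed.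

Lemma Re_chiN k : complex.Re (chi (- k)) = complex.Re (chi k).
Proof. by rewrite chiN; case: (chi k). Qed.

(** The angle 2 pi n / m stays within the first quadrant. *)
Lemma Re_chi_ge0 n : (4 * n <= m)%N -> 0 <= complex.Re (chi n%:R).
Proof.
move=> nm; rewrite chi_Re_nat cos_ge0_pihalf //.
have nmR : 4 * (n%:R / m%:R) <= 1 :> R.
  by rewrite mulrA ler_pdivrMr ?ltr0n // mul1r -natrM ler_nat.
have n0 : 0 <= n%:R / m%:R :> R by rewrite divr_ge0 ?ler0n.
have p0 := pi_gt0 R; rewrite -[pi * _ / _]mulrA; apply/andP; split; nra.
Qed.

Lemma Re_chi_lt0 n : (m < 4 * n)%N -> (4 * n < 3 * m)%N ->
  complex.Re (chi n%:R) < 0.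
Proof.
move=> mn nm; rewrite chi_Re_nat -[X in cos X](subrK pi) cosDpi oppr_lt0.
apply: cos_gt0_pihalf.
have nmR : 4 * (n%:R / m%:R) < 3 :> R.
  by rewrite mulrA ltr_pdivrMr ?ltr0n // -!natrM ltr_nat.
have mnR : 1 < 4 * (n%:R / m%:R) :> R.
  by rewrite mulrA ltr_pdivlMr ?ltr0n // mul1r -natrM ltr_nat.
have p0 := pi_gt0 R; rewrite -[pi * _ / _]mulrA; apply/andP; split; nra.
Qed.

Lemma Dir_chi n (l : 'Z_m) :
  Dir m n l = \sum_(a < n.*2.+1) chi ((a%:R - n%:R) * l) :> R[i].
Proof.
apply: eq_bigr => a _; rewrite [in RHS]mulrBl chiD chiN -[l in RHS]natr_Zp.
rewrite !chi_natM !chi_nat -!exprM -!expiMn conj_expi -expiD.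
by congr expi; rewrite /= !natrM; field.
Qed.

(** * The Dirichlet kernel and its translates for m = 4 q + 1 *)

Section QuarterSpectrum.
Variable q : nat.
Hypothesis m_def : m = (4 * q + 1)%N.

(** The frequencies -q, ..., q, shifted exactly as in [Dir_chi]. *)
Definition low_freq (a : 'I_q.*2.+1) : 'Z_m := a%:R - q%:R.

Lemma low_freq_inj : injective low_freq.
Proof.
move=> a b /addIr /(congr1 (@nat_of_ord _)); rewrite !val_Zp_nat //.
rewrite !modn_small; first exact: val_inj.
  by have := ltn_ord b; rewrite m_def; lia.
by have := ltn_ord a; rewrite m_def; lia.
Qed.

Lemma low_freq_eig a : cyc_eig (low_freq a) <= 2.
Proof.
have a_le := ltn_ord a; rewrite cyc_eig_le2 /low_freq.
have [qa|/ltnW aq] := leqP q a.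
  by rewrite -natrB // Re_chi_ge0 // m_def; lia.
by rewrite -Re_chiN opprB -natrB // Re_chi_ge0 // m_def; lia.
Qed.

Lemma low_freq_surj k : cyc_eig k <= 2 -> exists a, low_freq a = k.
Proof.
rewrite cyc_eig_le2 -[k]natr_Zp /low_freq.
have := ltn_ord k; rewrite [X in (_ < X)%N](Zp_cast m_gt1).
move: (nat_of_ord k) => n n_lt n_ge0.
have [nq|qn] := leqP n q.
  exists (inord (n + q)); rewrite inordK; last by lia.
  by rewrite natrD addrK.
have [nq|qn'] := ltnP n (3 * q + 1).
  by move: n_ge0; rewrite leNgt Re_chi_lt0 // m_def; lia.
(* Since 3 q + 1 = m - q, this index stands for the negative frequency n - m. The middle range,
   where the real part is negative, has just been excluded. *)
exists (inord (n - (3 * q + 1))); rewrite inordK; last by move: m_def; lia.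
have -> : n%:R = (n - (3 * q + 1))%:R + (3 * q + 1)%:R :> 'Z_m.
  by rewrite -natrD subnK.
congr (_ + _); apply/esym/eqP; rewrite -subr_eq0 opprK -natrD.
by rewrite (_ : (3 * q + 1 + q)%N = m) ?Zp_m_eq0 //; lia.
Qed.

Lemma low_fourier_onb :
  onb (PW (cycle_adj m) 2) (fun a => fourier (low_freq a)).
Proof.
rewrite (PW_coordsp fourier_onb fourier_eig).
apply: (coordsp_onb fourier_onb (h := low_freq)) => [|a|k].
- exact: low_freq_inj.
- exact: low_freq_eig.
exact: low_freq_surj.
Qed.

(** The kernel at 0 counts 2 q + 1 frequencies, so the value is (2 q + 1) / m with 2 q + 1 = (m + 1)
    / 2. *)
Lemma Dbar0 : `|Dbar m q 0 : R[i]| ^+ 2 = 2^-1 + (2 * m%:R)^-1.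
Proof.
have D0 : Dir m q 0 = q.*2.+1%:R :> R[i].
  by rewrite Dir_chi; under eq_bigr do rewrite mulr0 chi0; rewrite sumr_const card_ord.
rewrite normCK /Dbar D0 [_^*]rmorphM /= conjC_nat fmorphV /= conjC_real_complex.
rewrite mulrACA -invfM sqrtM_nat.
have : m%:R = 4 * q%:R + 1 :> R[i] by rewrite m_def natrD natrM.
have q0 : q.*2.+1%:R != 0 :> R[i] by rewrite pnatr_eq0.
have m0 : m%:R != 0 :> R[i] by rewrite pnatr_eq0 -lt0n.
rewrite natrM invfM; move: q0; rewrite -addn1 natrD -mul2n natrM => q0 mE.
rewrite mE in m0 *; field.
by rewrite m0 q0.
Qed.

(** The Vandermonde nodes: translating by 2 j multiplies the character of frequency [low_freq a] by
    the [j]-th power of its node. *)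
Let translate_coef (a : 'I_q.*2.+1) : R[i] := chi (- (2 * low_freq a)).

(** The scalar converts the normalisation of [fourier] into that of [Dbar]. *)
Let translate_mx : 'M[R[i]]_(q.*2.+1) :=
  \matrix_(j, a) ((Num.sqrt (m%:R : R))%:C / (Num.sqrt ((m * q.*2.+1)%:R : R))%:C
     * translate_coef a ^+ j).

Lemma Dbar_translate (j : 'I_q.*2.+1) :
  [ffun l => Dbar m q (l - (2 * j)%N%:R)] =
  \sum_a translate_mx j a *: fourier (low_freq a).
Proof.
apply/ffunP => l; rewrite fn_sumE ffunE /Dbar Dir_chi mulr_suml.
apply: eq_bigr => a _; rewrite mxE ffunE mulrBr natrM mulrA -mulNr.
rewrite chiD chi_natM /translate_coef [2 * _]mulrC.
set x := chi _; set y := chi _ ^+ j.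
rewrite fmorphV /=; have := sqrt_nat_neq0 m_gt0.
have : (0 < m * q.*2.+1)%N by rewrite muln_gt0 m_gt0.
move=> /sqrt_nat_neq0; set s := (Num.sqrt _)%:C; set t := (Num.sqrt _)%:C.
move: s t => s t s0 t0; rewrite -[RHS]/(_ * _).
by field; rewrite s0 t0.
Qed.

Lemma translate_mx_unit : translate_mx \in unitmx.
Proof.
pose V := Vandermonde q.*2.+1 (\row_a translate_coef a).
pose c := (Num.sqrt (m%:R : R))%:C / (Num.sqrt ((m * q.*2.+1)%:R : R))%:C.
have -> : translate_mx = c *: V by apply/matrixP => j a; rewrite !mxE.
rewrite unitmxE detZ unitfE mulf_neq0 ?expf_neq0 //.
  by rewrite mulf_neq0 ?invr_eq0 ?sqrt_nat_neq0 ?muln_gt0 ?m_gt0.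
rewrite det_Vandermonde; apply/prodf_neq0 => a _; apply/prodf_neq0 => b ab.
rewrite !mxE subr_eq0; apply: contraTneq ab => /chi_inj /oppr_inj ba.
suff -> : b = a by rewrite ltnn.
(* Equal nodes give equal doubled frequencies. Multiplying by 2 q undoes the doubling up to sign,
   because 4 q = -1 modulo m. *)
apply: low_freq_inj; move/(congr1 ( *%R (2 * q)%:R)): ba.
have q2 : (2 * q)%:R * 2 = -1 :> 'Z_m.
  apply/eqP; rewrite -subr_eq0 opprK -natrM natr1.
  by rewrite (_ : (2 * q * 2).+1 = m) ?Zp_m_eq0 //; lia.
by rewrite !mulrA q2 !mulN1r => /oppr_inj.
Qed.

(** The size [n] is a variable because the theorem counts translates by [((m - 1)./2).+1], whose
    equality with [q.*2.+1] has to be proved. *)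
Lemma Dbar_translate_basis n : n = q.*2.+1 ->
  is_basis (PW (cycle_adj m) 2)
    (fun j : 'I_n => [ffun l => Dbar m q (l - (2 * j)%N%:R)] : fn R 'Z_m).
Proof.
move=> ->; have -> : (fun j : 'I_q.*2.+1 => [ffun l => Dbar m q (l - (2 * j)%N%:R)])
    = fun j => \sum_a translate_mx j a *: fourier (low_freq a).
  by apply: funext => j; apply: Dbar_translate.
have [[lowP lowB] _] := low_fourier_onb.
apply: is_basis_mx translate_mx_unit _ _; first by split.
move=> j; rewrite (PW_coordsp fourier_onb fourier_eig) in lowP *.
by apply: coordsp_comb => a _; apply: lowP.
Qed.

End QuarterSpectrum.

End Cycle.

(** * The three spaces in the product of the cube and the cycle *)

Lemma le_shell_cases (R : realDomainType) (k K : nat) (mu : R) :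
    0 <= mu -> mu <= 4 ->
  (2 * k%:R + mu <= 2 * K%:R) =
  [|| (k.+2 <= K)%N, (k.+1 == K) && (mu <= 2) | (k == K) && (mu == 0)].
Proof.
move=> mu_ge0 mu_le4.
(* Level [k] leaves room 2 K - 2 k for [mu]: at least 4, exactly 2, exactly 0, or a negative
   amount. *)
have [kK|Kk] := leqP k.+2 K.
  have kKR : k%:R + 2 <= K%:R :> R by rewrite -natrD ler_nat addn2.
  by rewrite orTb; lra.
have [<-|kK1] := eqVneq k.+1 K.
  by rewrite -[k.+1%:R]natr1 (ltn_eqF (ltnSn k)) orbF /=; apply/idP/idP => H; lra.
have [<-|kK] := eqVneq k K.
  by rewrite /= gerDl eq_le mu_ge0 andbT.
apply/negbTE; rewrite -ltNge.
have : (K.+1)%:R <= k%:R :> R by rewrite ler_nat; lia.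
by rewrite -[K.+1%:R]natr1 => kKR; lra.
Qed.

Section Product.
Variables (R : realType) (N m K : nat).
Variable psi : forall k : nat, 'I_('C(N, k)) -> fn R 'rV['Z_2]_N.
Arguments psi : clear implicits.
Hypothesis m_ge3 : (3 <= m)%N.
Hypothesis K_bounds : (0 < K < N)%N.
Hypothesis psi_onb :
  forall k, (k <= N)%N -> onb (eigsp (cube_adj N) (2 * k%:R)) (psi k).

Lemma cube_shell_low k : (2 * k%:R <= 2 * K%:R - 4 :> R) = (k.+2 <= K)%N.
Proof. by rewrite -addn2 -(ler_nat R) natrD; apply/idP/idP => H; lra. Qed.

Lemma cube_shell_mid k : (2 * k%:R == 2 * K%:R - 2 :> R) = (k.+1 == K).
Proof.
rewrite -(eqr_nat R) -[k.+1%:R]natr1.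
by apply/eqP/eqP => H; lra.
Qed.

Lemma cube_shell_top k : (2 * k%:R == 2 * K%:R :> R) = (k == K).
Proof. by rewrite -(eqr_nat R); apply/eqP/eqP => H; lra. Qed.

Let cube_onb := cube_vec_onb psi_onb.
Let cube_eig := cube_vec_eig psi_onb.
Let fou_onb := fourier_onb R m_ge3.
Let fou_eig := fourier_eig R m_ge3.

(** All four spaces are rewritten as coordinate subspaces of one product eigenbasis, so that only
    [le_shell_cases] and the disjointness of the levels remain. *)
Lemma PW_box_odsum3 :
  odsum3 (PW (box_adj (cube_adj N) (cycle_adj m)) (2 * K%:R))
    (tens_sp (PW (cube_adj N) (2 * K%:R - 4)) (@fullsp R 'Z_m))
    (tens_sp (eigsp (cube_adj N) (2 * K%:R - 2)) (PW (cycle_adj m) 2))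
    (tens_sp (eigsp (cube_adj N) (2 * K%:R)) (eigsp (cycle_adj m) 0)).
Proof.
have full : @fullsp R 'Z_m = coordsp (@fourier R m) xpredT.
  by apply: funext => f; apply: propext.
have box_onb := tens_onb cube_onb fou_onb; rewrite tens_sp_full in box_onb.
have box_eig (p : {k : 'I_N.+1 & 'I_('C(N, k))} * 'Z_m) :
    lap (box_adj (cube_adj N) (cycle_adj m))
        (tens (cube_vec psi p.1) (fourier R p.2)) =
    (2 * (tag p.1)%:R + cyc_eig R p.2)%:C *:
      tens (cube_vec psi p.1) (fourier R p.2).
  rewrite lap_tens; last exact: cube_adj_irr.
  rewrite cube_eig fou_eig; apply/ffunP => x; rewrite !ffunE rmorphD.
  rewrite -![_ *: _]/(_ * _); ring.
rewrite (PW_coordsp box_onb box_eig) (PW_coordsp cube_onb cube_eig) full.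
rewrite !(eigsp_coordsp cube_onb cube_eig) (PW_coordsp fou_onb fou_eig).
rewrite (eigsp_coordsp fou_onb fou_eig) !(tens_coordsp _ _ cube_onb fou_onb).
apply: coordsp_odsum3 => // -[x l] /=.
- rewrite cube_shell_low cube_shell_mid cube_shell_top andbT le_shell_cases //.
    exact: cyc_eig_ge0.
  exact: cyc_eig_le4.
- by rewrite cube_shell_low cube_shell_mid; lia.
- by rewrite cube_shell_low cube_shell_top; lia.
- by rewrite cube_shell_mid cube_shell_top; lia.
Qed.

(** The levels kappa < K - 1 are those with 2 kappa <= 2 K - 4. For K = 1 the index type is empty
    and the space is zero. *)
Lemma PW_cube_low_onb :
  onb (PW (cube_adj N) (2 * K%:R - 4)) (fun x => @cube_vec _ _ psi K.-1 x).
Proof.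
rewrite (PW_coordsp cube_onb cube_eig); apply: cube_vec_sub_onb => //.
  by move: K_bounds; lia.
by move=> x; rewrite cube_shell_low; move: K_bounds; lia.
Qed.

Lemma S1_onb :
  onb (tens_sp (PW (cube_adj N) (2 * K%:R - 4)) (@fullsp R 'Z_m))
    (fun x : {jk : 'Z_m * 'I_K.-1 & 'I_('C(N, jk.2))} =>
      [ffun p => delta0 m (p.2 - (tag x).1) * psi (tag x).2 (tagged x) p.1]).
Proof.
(* The theorem groups [j] with the level, the tensor basis keeps it apart; [h] regroups the
   index. *)
pose h (x : {jk : 'Z_m * 'I_K.-1 & 'I_('C(N, jk.2))}) :=
  (existT (fun k : 'I_K.-1 => 'I_('C(N, k))) (tag x).2 (tagged x), (tag x).1).
have bij_h : bijective h.
  exists (fun y => existT (fun jk : 'Z_m * 'I_K.-1 => 'I_('C(N, jk.2)))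
                    (y.2, tag y.1) (tagged y.1)).
    by case=> -[j k] nu.
  by case=> -[k nu] j.
have := onb_reindex (tens_onb PW_cube_low_onb (delta_onb R _)) bij_h.
move=> /onb_ext; apply=> -[[j k] nu]; apply/ffunP => -[u l]; rewrite !ffunE /=.
by rewrite /delta0 subr_eq0 mulrC; case: (l == j).
Qed.

Lemma S1_dim :
  has_dim (tens_sp (PW (cube_adj N) (2 * K%:R - 4)) (@fullsp R 'Z_m))
    (m * \sum_(k < K.-1) 'C(N, k))%N.
Proof.
apply: is_basis_dim (tens_onb PW_cube_low_onb (delta_onb R _)).1.
rewrite card_prod (card_sig_ord _ (fun k => 'C(N, k))) card_ord mulnC.
by rewrite [X in (X * _)%N]Zp_cast // (ltn_trans _ m_ge3).
Qed.

Lemma S1_parseval f :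
  tens_sp (PW (cube_adj N) (2 * K%:R - 4)) (@fullsp R 'Z_m) f ->
  normsq (Qop N m f) =
  \sum_(k < K.-1) \sum_(nu < 'C(N, k))
    `|dotp (Qop N m f) [ffun p => delta0 m p.2 * psi k nu p.1]| ^+ 2.
Proof.
move=> /(Qop_parseval (@delta0 R m) PW_cube_low_onb) E.
rewrite (sig_big_dep (J := fun k : 'I_K.-1 => 'I_('C(N, k))) xpredT
  (fun=> xpredT) (fun k nu =>
    `|dotp (Qop N m f) [ffun p => delta0 m p.2 * psi k nu p.1]| ^+ 2)) /=.
by rewrite [RHS]E /delta0 eqxx normr1 expr1n mul1r.
Qed.

Lemma eigsp_mid_onb : onb (eigsp (cube_adj N) (2 * K%:R - 2)) (psi K.-1).
Proof.
have -> : 2 * K%:R - 2 = 2 * (K.-1)%:R :> R.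
  by apply/esym/eqP; rewrite cube_shell_mid; move: K_bounds; lia.
by apply: psi_onb; move: K_bounds; lia.
Qed.

Section S2.
Variable q : nat.
Hypothesis m_def : m = (4 * q + 1)%N.

Lemma S2_basis :
  is_basis
    (tens_sp (eigsp (cube_adj N) (2 * K%:R - 2)) (PW (cycle_adj m) 2))
    (fun x : 'I_((m - 1)./2).+1 * 'I_('C(N, K.-1)) =>
      [ffun p => Dbar m q (p.2 - (2 * x.1)%N%:R) * psi K.-1 x.2 p.1]).
Proof.
have n_def : ((m - 1)./2).+1 = q.*2.+1 by rewrite m_def; lia.
have := tens_is_basis eigsp_mid_onb.1 (Dbar_translate_basis R m_ge3 m_def n_def).
move=> /(is_basis_reindex (h := fun x => (x.2, x.1))).
have bij_swap : bijective (fun x : 'I_((m - 1)./2).+1 * 'I_('C(N, K.-1)) => (x.2, x.1)).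
  by exists (fun x => (x.2, x.1)) => -[].
move=> /(_ bij_swap); congr (is_basis _ _); apply: funext => -[j nu] /=.
by apply/ffunP => -[u l]; rewrite !ffunE /= mulrC.
Qed.

Lemma S2_parseval f :
  tens_sp (eigsp (cube_adj N) (2 * K%:R - 2)) (PW (cycle_adj m) 2) f ->
  (2^-1 + (2 * m%:R)^-1) * normsq (Qop N m f) =
  \sum_(nu < 'C(N, K.-1))
    `|dotp (Qop N m f) [ffun p => Dbar m q p.2 * psi K.-1 nu p.1]| ^+ 2.
Proof.
move=> /(Qop_parseval (@Dbar R m q) eigsp_mid_onb) ->.
by rewrite (Dbar0 R m_ge3 m_def).
Qed.

End S2.

Lemma S3_onb :
  onb (tens_sp (eigsp (cube_adj N) (2 * K%:R)) (eigsp (cycle_adj m) 0))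
    (fun nu : 'I_('C(N, K)) =>
      [ffun p => (Num.sqrt (m%:R : R))^-1%:C * psi K nu p.1]).
Proof.
have KN : (K <= N)%N by move: K_bounds; lia.
have := tens_onb (psi_onb KN) (zero_eigsp_cycle_onb R m_ge3).
move=> /onb_reindex/(_ _ (fun nu => (nu, tt))).
have bij_tt : bijective (fun nu : 'I_('C(N, K)) => (nu, tt)).
  by exists fst => // -[? []].
move=> /(_ bij_tt); move=> /onb_ext; apply=> nu; apply/ffunP => -[u l].
by rewrite !ffunE /= mulrC.
Qed.

Lemma S3_parseval f :
  tens_sp (eigsp (cube_adj N) (2 * K%:R)) (eigsp (cycle_adj m) 0) f ->
  (m%:R)^-1 * normsq (Qop N m f) =
  \sum_(nu < 'C(N, K))
    `|dotp (Qop N m f) [ffun p => (Num.sqrt (m%:R : R))^-1%:C * psi K nu p.1]| ^+ 2.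
Proof.
have KN : (K <= N)%N by move: K_bounds; lia.
move=> /(Qop_parseval (fun=> (Num.sqrt (m%:R : R))^-1%:C) (psi_onb KN)) ->.
by rewrite normCK conjC_real_complex fmorphV -invfM sqrtM_nat.
Qed.

End Product.

Theorem theorem4 (R : realType) (N m K : nat)
  (psi : forall k : nat, 'I_('C(N, k)) -> fn R 'rV['Z_2]_N) :
  (2 <= N)%N -> (3 <= m)%N -> (0 < K < N)%N ->
  (* for each kappa, psi kappa is an orthonormal basis of Lambda_{2 kappa}(B_N) *)
  (forall k : nat, (k <= N)%N -> onb (eigsp (cube_adj N) (2 * k%:R)) (psi k)) ->
  let G := box_adj (cube_adj N) (cycle_adj m) in
  let S1 := tens_sp (PW (cube_adj N) (2 * K%:R - 4)) (@fullsp R 'Z_m) in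
  let S2 := tens_sp (eigsp (cube_adj N) (2 * K%:R - 2)) (PW (cycle_adj m) 2) in
  let S3 := tens_sp (eigsp (cube_adj N) (2 * K%:R)) (eigsp (cycle_adj m) 0) in
  odsum3 (PW G (2 * K%:R)) S1 S2 S3 /\
  (* 1. *)
  [/\ has_dim S1 (m * \sum_(k < K.-1) 'C(N, k))%N,
      onb S1 (fun x : {jk : 'Z_m * 'I_K.-1 & 'I_('C(N, jk.2))} =>
                [ffun p => delta0 m (p.2 - (tag x).1) * psi (tag x).2 (tagged x) p.1])
    & forall f, S1 f ->
        normsq (Qop N m f) =
        \sum_(k < K.-1) \sum_(nu < 'C(N, k))
          `|dotp (Qop N m f) [ffun p => delta0 m p.2 * psi k nu p.1]| ^+ 2] /\
  (* 2. *)
  (forall m' : nat, (0 < m')%N -> m = (4 * m' + 1)%N ->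
    [/\ has_dim S2 ((m + 1)./2 * 'C(N, K.-1))%N,
        is_basis S2 (fun x : 'I_((m - 1)./2).+1 * 'I_('C(N, K.-1)) =>
                  [ffun p => Dbar m m' (p.2 - (2 * x.1)%N%:R) * psi K.-1 x.2 p.1])
      & forall f, S2 f ->
          (2^-1 + (2 * m%:R)^-1) * normsq (Qop N m f) =
          \sum_(nu < 'C(N, K.-1))
            `|dotp (Qop N m f) [ffun p => Dbar m m' p.2 * psi K.-1 nu p.1]| ^+ 2]) /\
  (* 3. *)
  [/\ has_dim S3 'C(N, K),
      onb S3 (fun nu : 'I_('C(N, K)) =>
                [ffun p => (Num.sqrt (m%:R : R))^-1%:C * psi K nu p.1])
    & forall f, S3 f ->
        (m%:R)^-1 * normsq (Qop N m f) =
        \sum_(nu < 'C(N, K))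
          `|dotp (Qop N m f) [ffun p => (Num.sqrt (m%:R : R))^-1%:C * psi K nu p.1]| ^+ 2].
Proof.
move=> N_ge2 m_ge3 K_bounds psi_onb G S1 S2 S3; split; [|split; [|split]].
- exact: PW_box_odsum3 m_ge3 K_bounds psi_onb.
- split.
  + exact: S1_dim m_ge3 K_bounds psi_onb.
  + exact: S1_onb K_bounds psi_onb.
  + exact: S1_parseval K_bounds psi_onb.
- move=> q q_gt0 m_def; have basis := S2_basis m_ge3 K_bounds psi_onb m_def.
  split; [|exact: basis|exact: S2_parseval m_ge3 K_bounds psi_onb q m_def].
  by apply: is_basis_dim basis; rewrite card_prod !card_ord m_def; congr (_ * _)%N; lia.
have basis := S3_onb m_ge3 K_bounds psi_onb; split.
- by apply: is_basis_dim basis.1; rewrite card_ord.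
- exact: basis.
exact: S3_parseval m_ge3 K_bounds psi_onb.
Qed.
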